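(* For every $n\ge 1$ with $n\ne 2$, the monomial function $p:\mathrm{GF}(2)^n\to\mathrm{GF}(2)$, $p(\mathbf{x})=x_0x_1x_2\cdots x_{n-1}$, of degree $n$ in $n$ variables has exactly $n+1$ flat spectra with respect to $\{I,H,N\}^n$.
   Context: Let $I$ be the $2\times 2$ identity matrix, $H=\frac{1}{\sqrt2}\begin{pmatrix}1&1\\1&-1\end{pmatrix}$, and $N=\frac{1}{\sqrt2}\begin{pmatrix}1&i\\1&-i\end{pmatrix}$ with $i^2=-1$. $\{I,H,N\}^n$ denotes the set of $3^n$ transforms $U=U_0\otimes U_1\otimes\cdots\otimes U_{n-1}$ with each $U_j\in \{I,H,N\}$ (the factor $U_j$ acts on the tensor position of variable $x_j$); each transform is identified with the choice $(U_0,\ldots,U_{n-1})$. For a Boolean function $p:\mathrm{GF}(2)^n\to\mathrm{GF}(2)$, let $(-1)^{p}\in\mathbb{C}^{2^n}$ be the vector with entries $(-1)^{p(\mathbf{x})}$ indexed by $\mathbf{x}=(x_0,\ldots,x_{n-1})\in\mathrm{GF}(2)^n$. The spectrum of $p$ with respect to $U$ is $P=U(-1)^p=(P_{\mathbf{k}})_{\mathbf{k}\in\mathrm{GF}(2)^n}$, and it is flat if $|P_{\mathbf{k}}|=1$ for all $\mathbf{k}$. The number of flat spectra of $p$ with respect to $\{I,H,N\}^n$ is the number of choices $(U_0,\ldots,U_{n-1})$ for which the spectrum of $p$ is flat. *)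

(* Defs.v *)
(* MathComp; the complex field is R[i] over an arbitrary R : realType. *)
From HB Require Import structures.
From mathcomp Require Import all_boot all_order all_algebra.
From mathcomp Require Import reals complex.
Set Implicit Arguments.
Unset Strict Implicit.
Unset Printing Implicit Defensive.
Import Order.TTheory GRing.Theory Num.Theory.
Local Open Scope ring_scope.

Definition mx2 (T : Type) (a b c d : T) : 'M[T]_2 :=
  \matrix_(r < 2, s < 2)
    if r == 0 then (if s == 0 then a else b) else (if s == 0 then c else d).

Definition mxI (R : realType) : 'M[R[i]]_2 := 1%:M.

Definition mxH (R : realType) : 'M[R[i]]_2 :=
  (Num.sqrt (2 : R))%:C%C^-1 *: mx2 1 1 1 (- 1).

Definition mxN (R : realType) : 'M[R[i]]_2 :=
  (Num.sqrt (2 : R))%:C%C^-1 *: mx2 1 ('i)%C 1 (- 'i)%C.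

Inductive gate := GateI | GateH | GateN.

Definition ord_of_gate (g : gate) : 'I_3 :=
  match g with GateI => inord 0 | GateH => inord 1 | GateN => inord 2 end.

Definition gate_of_ord (m : 'I_3) : gate :=
  match val m with 0 => GateI | 1 => GateH | _ => GateN end%N.

Lemma ord_of_gateK : cancel ord_of_gate gate_of_ord.
Proof. by case; rewrite /gate_of_ord /= inordK. Qed.

HB.instance Definition _ := Finite.copy gate (can_type ord_of_gateK).

Definition gate_mx (R : realType) (g : gate) : 'M[R[i]]_2 :=
  match g with GateI => mxI R | GateH => mxH R | GateN => mxN R end.

(* Operators on C^(2^n) are given by their entries, rows and columns being
   indexed by GF(2)^n = 'rV['F_2]_n.  The (k, x) entry of the Kronecker product
   U_0 (x) ... (x) U_(n-1) is the product over j of the (k_j, x_j) entries of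
   the U_j; 'F_2 is convertible to the index type 'I_2 of the factors. *)
Definition tensor_entry (R : realType) (n : nat) (U : 'I_n -> 'M[R[i]]_2)
    (k x : 'rV['F_2]_n) : R[i] :=
  \prod_(j < n) U j (k 0 j) (x 0 j).

Definition sign_vec (R : realType) (n : nat) (p : 'rV['F_2]_n -> 'F_2)
    (x : 'rV['F_2]_n) : R[i] :=
  (- 1) ^+ (p x : nat).

Definition spectrum (R : realType) (n : nat) (U : {ffun 'I_n -> gate})
    (p : 'rV['F_2]_n -> 'F_2) (k : 'rV['F_2]_n) : R[i] :=
  \sum_(x : 'rV['F_2]_n)
    tensor_entry (fun j => gate_mx R (U j)) k x * sign_vec R p x.

Definition flat (R : realType) (n : nat) (U : {ffun 'I_n -> gate})
    (p : 'rV['F_2]_n -> 'F_2) : bool :=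
  [forall k : 'rV['F_2]_n, `|spectrum R U p k| == 1].

Definition num_flat (R : realType) (n : nat) (p : 'rV['F_2]_n -> 'F_2) : nat :=
  #|[set U : {ffun 'I_n -> gate} | flat R U p]|.

Definition monomial (n : nat) (x : 'rV['F_2]_n) : 'F_2 :=
  \prod_(j < n) x 0 j.

(* Main.v *)
(* The signs of the monomial are 1 - 2 [x = (1,...,1)], so the spectrum at k is
   prod_j A_j(k_j) - 2 prod_j B_j(k_j), where A_j(r) is the sum of row r of U_j
   and B_j(r) its last entry.  An H at position j makes A_j(1) vanish, so the
   spectrum at a suitable k is 0 if some factor is I, and has modulus
   2 / sqrt(2)^n otherwise, which is 1 only for n = 2.  If there is no H but two
   factors are N, the spectra at two suitable k's are d + c i and d - c i with
   |c| = 1 and d <> 0, and the parallelogram identity forbids that both have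
   modulus 1.  The remaining n + 1 transforms, all I or a single N, are flat. *)
Require Import Defs.
From mathcomp Require Import all_boot all_order all_algebra.
From mathcomp Require Import reals complex.
From mathcomp Require Import ring.
Set Implicit Arguments.
Unset Strict Implicit.
Unset Printing Implicit Defensive.
Import Order.TTheory GRing.Theory Num.Theory.
Local Open Scope ring_scope.

(** This is general distributivity, with the choice functions of [bigA_distr_bigA] reread as row
    vectors. *)
Lemma prod_row_distr (K : comNzRingType) (T : finType) (n : nat)
    (F : 'I_n -> T -> K) :
  \sum_(x : 'rV[T]_n) \prod_(j < n) F j (x 0 j) = \prod_(j < n) \sum_(r : T) F j r.
Proof.
rewrite bigA_distr_bigA /=.
rewrite (reindex (fun f : {ffun 'I_n -> T} => \row_j f j)) /=.
  by apply: eq_bigr => f _; apply: eq_bigr => j _; rewrite mxE.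
exists (fun x : 'rV[T]_n => [ffun j => x 0 j]) => x _.
  by apply/ffunP => j; rewrite ffunE mxE.
by apply/rowP => j; rewrite mxE ffunE.
Qed.

Lemma prodr_eq0 (K : comNzRingType) (I : finType) (P : pred I) (F : I -> K)
    (i : I) :
  P i -> F i = 0 -> \prod_(j | P j) F j = 0.
Proof. by move=> Pi Fi0; rewrite (bigD1 i) //= Fi0 mul0r. Qed.

Lemma F2_neq0 (a : 'F_2) : a != 0 -> a = 1.
Proof. by case: a => [[|[|m]] lt_m] // _; apply/val_inj. Qed.

Lemma sign_monomial (R : realType) (n : nat) (x : 'rV['F_2]_n) :
  sign_vec R (@monomial n) x = 1 - 2 * \prod_(j < n) (x 0 j == 1)%:R.
Proof.
rewrite /sign_vec /monomial.
have [/forallP x1|] := boolP [forall j, x 0 j == 1].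
  rewrite big1 => [|j _]; last exact/eqP.
  by rewrite big1 => [|j _]; [rewrite expr1; ring | rewrite x1].
rewrite negb_forall => /existsP [j xj].
have xj0 : x 0 j = 0 by apply/eqP; apply: contraNT xj => /F2_neq0 ->.
rewrite (prodr_eq0 _ xj0) // expr0 (@prodr_eq0 _ _ xpredT _ j) ?mulr0 ?subr0 //.
by rewrite xj0.
Qed.

Section GateRows.
Variable R : realType.
Implicit Types (g : gate) (r : 'F_2).

Definition row_sum g r : R[i] := gate_mx R g r 0 + gate_mx R g r 1.
Definition row_last g r : R[i] := gate_mx R g r 1.
Definition isqrt2 : R[i] := (Num.sqrt (2 : R))%:C%C^-1.

(** The constant 1 and the indicator of the all-ones vector are both products over the coordinates,
    so each of the two sums over [x] factors. *)
Lemma spectrum_monomial (n : nat) (U : {ffun 'I_n -> gate}) (k : 'rV['F_2]_n) :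
  spectrum R U (@monomial n) k =
  \prod_(j < n) row_sum (U j) (k 0 j) - 2 * \prod_(j < n) row_last (U j) (k 0 j).
Proof.
pose F j (r : 'F_2) := gate_mx R (U j) (k 0 j) r.
have -> : \prod_(j < n) row_sum (U j) (k 0 j) =
    \sum_(x : 'rV['F_2]_n) \prod_(j < n) F j (x 0 j).
  rewrite prod_row_distr; apply: eq_bigr => j _.
  by rewrite big_ord_recl big_ord1; congr (_ + F j _); apply/val_inj.
have -> : \prod_(j < n) row_last (U j) (k 0 j) =
    \sum_(x : 'rV['F_2]_n) \prod_(j < n) (F j (x 0 j) * (x 0 j == 1)%:R).
  rewrite (prod_row_distr (fun j r => F j r * (r == 1)%:R)).
  apply: eq_bigr => j _; rewrite (bigD1 1) //= mulr1 big1 ?addr0 // => r.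
  by move/negbTE ->; rewrite mulr0.
rewrite mulr_sumr -sumrB; apply: eq_bigr => x _.
rewrite sign_monomial big_split /= /tensor_entry -/(F _ _).
by rewrite mulrBr mulr1 mulrCA.
Qed.

Lemma isqrt2_sqr : isqrt2 ^+ 2 = 2^-1.
Proof.
rewrite /isqrt2 exprVn -rmorphXn /= sqr_sqrtr ?ler0n //.
by rewrite rmorph_nat.
Qed.

Lemma isqrt2_ge0 : 0 <= isqrt2.
Proof. by rewrite invr_ge0 ler0c sqrtr_ge0. Qed.

Lemma norm_isqrt2 : `|isqrt2| = isqrt2.
Proof. exact: ger0_norm isqrt2_ge0. Qed.

Lemma imag_sqr : ('i%C : R[i]) ^+ 2 = -1.
Proof. exact: sqr_i. Qed.

Lemma conj_imag : ('i%C : R[i])^* = - 'i%C.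
Proof. by apply/eqP; rewrite eq_complex /= oppr0 !eqxx. Qed.

Lemma norm_imag : `|'i%C : R[i]| = 1.
Proof.
by apply: (@pexpIrn _ 2) => //; rewrite ?nnegrE // -normrX imag_sqr normrN1 expr1n.
Qed.

(** The number is an eighth root of unity: its square is ['i], of modulus 1. *)
Lemma norm_isqrt2_1pi : `|isqrt2 * (1 + 'i%C)| = 1.
Proof.
apply: (@pexpIrn _ 2) => //; rewrite ?nnegrE // -normrX exprMn isqrt2_sqr.
have -> : 2^-1 * (1 + 'i%C) ^+ 2 = 'i%C :> R[i].
  by rewrite sqrrD imag_sqr; field.
by rewrite norm_imag expr1n.
Qed.

Lemma norm_isqrt2_1mi : `|isqrt2 * (1 - 'i%C)| = 1.
Proof.
apply: (@pexpIrn _ 2) => //; rewrite ?nnegrE // -normrX exprMn isqrt2_sqr.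
have -> : 2^-1 * (1 - 'i%C) ^+ 2 = - 'i%C :> R[i].
  by rewrite sqrrB imag_sqr; field.
by rewrite normrN norm_imag expr1n.
Qed.

Lemma row_sumI r : row_sum GateI r = 1.
Proof.
by rewrite /row_sum !mxE; case: r => [[|[|m]] lt_m] //=; rewrite ?addr0 ?add0r.
Qed.

Lemma row_lastI r : row_last GateI r = (r == 1)%:R.
Proof. by rewrite /row_last !mxE. Qed.

Lemma row_sumH1 : row_sum GateH 1 = 0.
Proof. by rewrite /row_sum !mxE /= -mulrDr subrr mulr0. Qed.

Lemma row_sumN0 : row_sum GateN 0 = isqrt2 * (1 + 'i%C).
Proof. by rewrite /row_sum !mxE /= -mulrDr. Qed.

Lemma row_sumN1 : row_sum GateN 1 = isqrt2 * (1 - 'i%C).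
Proof. by rewrite /row_sum !mxE /= -mulrDr. Qed.

Lemma row_lastN0 : row_last GateN 0 = isqrt2 * 'i%C.
Proof. by rewrite /row_last !mxE. Qed.

Lemma row_lastN1 : row_last GateN 1 = - (isqrt2 * 'i%C).
Proof. by rewrite /row_last !mxE /= mulrN. Qed.

Lemma norm_row_sumN r : `|row_sum GateN r| = 1.
Proof.
have [->|/F2_neq0 ->] := eqVneq r 0.
  by rewrite row_sumN0 norm_isqrt2_1pi.
by rewrite row_sumN1 norm_isqrt2_1mi.
Qed.

Lemma norm_row_last g r : g != GateI -> `|row_last g r| = isqrt2.
Proof.
case: g => [/eqP //|_|_]; have [->|/F2_neq0 ->] := eqVneq r 0.
- by rewrite /row_last !mxE /= mulr1 norm_isqrt2.
- by rewrite /row_last !mxE /= mulrN1 normrN norm_isqrt2.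
- by rewrite row_lastN0 normrM norm_imag mulr1 norm_isqrt2.
- by rewrite row_lastN1 normrN normrM norm_imag mulr1 norm_isqrt2.
Qed.

Lemma row_last1_neq0 g : row_last g 1 != 0.
Proof.
have [->|gI] := eqVneq g GateI; first by rewrite row_lastI oner_neq0.
by rewrite -normr_eq0 norm_row_last // -sqrf_eq0 isqrt2_sqr invr_eq0 pnatr_eq0.
Qed.

(** Subtracting twice the last entry applies the row to (1, -1) instead of (1, 1); for N this
    exchanges the two row sums. *)
Lemma norm_row_N r : `|row_sum GateN r - 2 * row_last GateN r| = 1.
Proof.
have [->|/F2_neq0 ->] := eqVneq r 0.
  rewrite row_sumN0 row_lastN0 -[RHS]norm_isqrt2_1mi; congr `|_|; ring.
rewrite row_sumN1 row_lastN1 -[RHS]norm_isqrt2_1pi; congr `|_|; ring.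
Qed.

(** By the parallelogram identity, 2|v|^2 = |v + u|^2 + |v - u|^2 - 2|u|^2 = 1 + 1 - 2 = 0. *)
Lemma parallelogram_unit (u v : R[i]) :
  `|u| = 1 -> `|v + u| = 1 -> `|v - u| = 1 -> v = 0.
Proof.
have E z : `|z| = 1 -> z * z^* = 1 by move=> z1; rewrite -normCK z1 expr1n.
move=> /E u1 /E; rewrite rmorphD /= => p1 /E; rewrite rmorphB /= => m1.
have : 2 * (v * v^*) = 0.
  transitivity ((v + u) * (v^* + u^*) + (v - u) * (v^* - u^*) - 2 * (u * u^*)).
    ring.
  rewrite p1 m1 u1; ring.
move/eqP; rewrite -normCK !mulf_eq0 pnatr_eq0 /= orbb normr_eq0.
by move/eqP.
Qed.

(** [None] stands for the transform with all factors I, so the index type has exactly n + 1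
    elements. *)
Definition single_N (n : nat) (o : option 'I_n) : {ffun 'I_n -> gate} :=
  [ffun j => if o == Some j then GateN else GateI].

Lemma single_N_inj n : injective (@single_N n).
Proof.
have sN o j : (@single_N n o j == GateN) = (o == Some j).
  by rewrite ffunE; case: (o == _); apply/eqP.
move=> [j|] o eqs.
  by have := sN o j; rewrite -eqs sN eqxx => /esym/eqP.
by case: o eqs => // j eqs; have := sN (Some j) j; rewrite -eqs sN eqxx.
Qed.

Lemma flat_single_N n (o : option 'I_n) :
  (0 < n)%N -> flat R (single_N o) (@monomial n).
Proof.
move=> n_gt0; apply/forallP => k; rewrite spectrum_monomial; apply/eqP.
(* For [None] any position can be singled out; position 0 exists because n > 0. *)
pose j0 := odflt (Ordinal n_gt0) o.
have oI j : j != j0 -> single_N o j = GateI.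
  rewrite /j0 ffunE; case: o j0 => [j1|] //= _ jj1.
  by case: eqP => // -[] jE; rewrite jE eqxx in jj1.
rewrite (bigD1 j0) //= big1 => [|j /oI ->]; last exact: row_sumI.
rewrite mulr1 (bigD1 j0) //=.
(* All factors off [j0] are I, so [t] is the indicator that [k] is 1 there, and the spectrum is the
   row sum at [j0] minus 2[t] times the last entry. *)
set t := \prod_(j < n | j != j0) _.
have t01 : t = 0 \/ t = 1.
  have [/forall_inP k1|] := boolP [forall (j | j != j0), k 0 j == 1].
    by right; apply: big1 => j jj0; rewrite oI // row_lastI k1.
  case/forall_inPn => j jj0 kj; left.
  by apply: (prodr_eq0 jj0); rewrite oI // row_lastI (negbTE kj).
have : single_N o j0 = GateI \/ single_N o j0 = GateN.
  by rewrite ffunE; case: ifP; [right | left].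
case: t01 => ->; rewrite ?mulr0 ?mulr1 ?subr0 => -[] ->.
- by rewrite row_sumI normr1.
- exact: norm_row_sumN.
- rewrite row_sumI row_lastI; case: (_ == _); rewrite ?mulr0 ?subr0 ?normr1 //.
  have -> : 1 - 2 * 1%:R = -1 :> R[i] by ring.
  exact: normrN1.
- exact: norm_row_N.
Qed.

Lemma flat_noH n (U : {ffun 'I_n -> gate}) (j : 'I_n) :
  n <> 2%N -> flat R U (@monomial n) -> U j != GateH.
Proof.
move=> n2 /forallP flatU; apply/eqP => Uj.
(* The 1 at [j] kills the row sum of H; a 0 elsewhere makes the last entry of any factor I
   vanish. *)
pose k : 'rV['F_2]_n := delta_mx 0 j.
have := flatU k; rewrite spectrum_monomial.
rewrite (bigD1 j) //= Uj mxE !eqxx row_sumH1 mul0r sub0r normrN.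
have [/existsP [l /eqP Ul]|noI] := boolP [exists l, U l == GateI].
  have lj : l != j by apply/eqP => lj; rewrite -lj Ul in Uj.
  rewrite (bigD1 l) //= Ul row_lastI mxE (negbTE lj) mul0r mulr0 normr0.
  by rewrite eq_sym oner_eq0.
rewrite normrM normr_nat normr_prod.
under eq_bigr => l _.
  rewrite norm_row_last; last by move: noI; rewrite negb_exists => /forallP.
  over.
rewrite prodr_const card_ord => /eqP norm1.
(* Squaring removes the root: 4 / 2^n = 1, hence n = 2. *)
have : (2 * isqrt2 ^+ n) ^+ 2 = 1 by rewrite norm1 expr1n.
rewrite exprMn -exprM mulnC exprM isqrt2_sqr exprVn.
move/(canRL (mulfK _)) => /(_ _) E.
have {}E : (2 ^+ 2 : R[i]) = 2 ^+ n.
  by rewrite E ?mul1r ?invrK // invr_eq0 expf_eq0 pnatr_eq0 andbF.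
apply: n2; move: E; rewrite -!natrX => /eqP; rewrite eqr_nat.
by rewrite eqn_exp2l // => /eqP.
Qed.

Lemma flat_one_N n (U : {ffun 'I_n -> gate}) (j l : 'I_n) :
  (forall m, U m != GateH) -> flat R U (@monomial n) ->
  U j = GateN -> U l = GateN -> l = j.
Proof.
move=> noH /forallP flatU Uj Ul; apply/eqP; apply/negPn/negP => lj.
(* Off the two N positions [k r] is 1, where no gate has a zero last entry; this makes [d]
   nonzero. *)
pose k r : 'rV['F_2]_n := \row_m if m \in [:: j; l] then r else 1.
pose c := \prod_(m < n | (m != j) && (m != l)) row_sum (U m) 1.
pose d := \prod_(m < n | (m != j) && (m != l)) row_last (U m) 1.
have split_jl (F : gate -> 'F_2 -> R[i]) r : \prod_(m < n) F (U m) (k r 0 m) =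
    F GateN r ^+ 2 * \prod_(m < n | (m != j) && (m != l)) F (U m) 1.
  rewrite (bigD1 j) //= (bigD1 l) //= !mxE !inE !eqxx orbT Uj Ul mulrA -expr2.
  congr (_ * _); apply: eq_bigr => m /andP [mj ml].
  by rewrite mxE !inE (negbTE mj) (negbTE ml).
have normc : `|'i%C * c| = 1.
  rewrite normrM norm_imag mul1r normr_prod big1 // => m _.
  by case: (U m) (noH m) => [_|/eqP //|_]; rewrite ?norm_row_sumN ?row_sumI ?normr1.
have d0 : d = 0.
  (* The squared row sums of N are ['i] and [- 'i], and both squared last entries are -1/2, so the
     spectra at [k 0] and [k 1] are [d + 'i * c] and [d - 'i * c]. *)
  apply: (parallelogram_unit normc).
    have /eqP <- := flatU (k 0).
    rewrite spectrum_monomial !split_jl row_sumN0 row_lastN0 -/c -/d.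
    by congr `|_|; rewrite !exprMn isqrt2_sqr sqrrD imag_sqr; field.
  have /eqP <- := flatU (k 1).
  rewrite spectrum_monomial !split_jl row_sumN1 row_lastN1 -/c -/d.
  by congr `|_|; rewrite sqrrN !exprMn isqrt2_sqr sqrrB imag_sqr; field.
move/eqP: d0; apply/negP; apply/prodf_neq0 => m _; exact: row_last1_neq0.
Qed.

Lemma flat_monomialE n (U : {ffun 'I_n -> gate}) :
  (0 < n)%N -> n <> 2%N ->
  flat R U (@monomial n) = (U \in codom (@single_N n)).
Proof.
move=> n_gt0 n2; apply/idP/idP => [flatU|/codomP [o ->]]; last first.
  exact: flat_single_N.
have noH m : U m != GateH by exact: flat_noH.
(* A position carrying N, if there is one, is unique by [flat_one_N]; all other factors are then
   I. *)
apply/codomP; case: (pickP (fun j => U j == GateN)) => [j /eqP Uj|noN].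
  exists (Some j); apply/ffunP => l; rewrite ffunE.
  case: eqP => [[<-] //|jl]; case Ul: (U l) => //.
    by have := noH l; rewrite Ul eqxx.
  by case: jl; rewrite (flat_one_N noH flatU Uj Ul).
exists None; apply/ffunP => l; rewrite ffunE /=.
by case: (U l) (noH l) (noN l) => [|/eqP //|_]; rewrite ?eqxx.
Qed.

End GateRows.

Local Close Scope ring_scope.

Theorem lemma8 (R : realType) (n : nat) (hn1 : (1 <= n)%N) (hn2 : n <> 2) :
  num_flat R (@monomial n) = n.+1.
Proof.
rewrite /num_flat (eq_card (B := mem (codom (@single_N n)))); last first.
  by move=> U; rewrite inE flat_monomialE.
by rewrite (card_codom (@single_N_inj n)) card_option card_ord.
Qed.
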